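(* Let $r\ge1$ and let $p_1,\ldots,p_r\ge2$ be pairwise coprime integers. The set $E:=S(p_1,\ldots,p_r)$ is closed in $\mathbb Z$ for the Bohr topology, and thus $E$ is not a recurrent set. In particular this holds for $S=S(2,3)=\{2^j3^k: j,k\ge0\}$.
   Context: $S(p_1,\ldots,p_r)=\{p_1^{a_1}\cdots p_r^{a_r}: a_1,\ldots,a_r\in\{0,1,2,\ldots\}\}$ is the multiplicative semigroup generated by $p_1,\ldots,p_r$. The Bohr topology on $\mathbb Z$ is the group topology having as a basis of neighbourhoods of $0$ the sets $V(x_1,\ldots,x_k,\varepsilon)=\{n\in\mathbb Z: |e^{2i\pi nx_j}-1|<\varepsilon \text{ for } 1\le j\le k\}$, with $k\ge 1$, $\varepsilon>0$ and $x_1,\ldots,x_k\in\mathbb R$. A set $E\subset\mathbb Z$ is recurrent if for every measure-preserving dynamical system $(X,\mathcal A,\mu,T)$ (with $\mu$ a probability measure) and every $A\in\mathcal A$ with $\mu(A)>0$ there exists $h\in E$ such that $\mu(A\cap T^{-h}A)>0$. *)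

(* Defs.v *)
From HB Require Import structures.
From mathcomp Require Import all_boot all_order all_algebra.
From mathcomp Require Import all_classical all_reals all_analysis.
From mathcomp Require Import complex.
From mathcomp Require Import ring lra.

Set Implicit Arguments.
Unset Strict Implicit.
Unset Printing Implicit Defensive.

Import Order.TTheory GRing.Theory Num.Theory.
Import numFieldNormedType.Exports.

Local Open Scope classical_set_scope.
Local Open Scope ring_scope.

Definition gen_semigroup (r : nat) (p : r.-tuple int) : set int :=
  [set n | exists a : 'I_r -> nat, n = \prod_(i < r) tnth p i ^+ a i].

(* [expi t] is e^{it}. *)
Definition expi (R : realType) (t : R) : R[i] := (cos t +i* sin t)%C.

(* The set V(x_1, ..., x_k, eps), with s listing x_1, ..., x_k. *)
Definition bohr_set (R : realType) (s : seq R) (eps : R) : set int :=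
  [set n | forall x, x \in s ->
     `|expi (2 * pi * n%:~R * x) - 1| < (eps%:C)%C].

(* The index set k >= 1, eps > 0 of the basis. *)
Definition bohr_index (R : realType) : set (seq R * R) :=
  [set i | i.1 != [::] /\ 0 < i.2].

(* An alias of [int], so that the Bohr topology does not compete with any
   other topology on [int]; the parameter R is where the x_j live. *)
Definition bohr_int (R : realType) : Type := int.

(* Neighbourhoods of n are the n-translates of neighbourhoods of 0: m lies in
   n + V iff m - n lies in V. *)
Definition bohr_nbhs (R : realType) (n : bohr_int R) :
    set_system (bohr_int R) :=
  filter_from (bohr_index (R := R))
    (fun i => [set m : int | bohr_set i.1 i.2 (m - (n : int))]).

HB.instance Definition _ (R : realType) :=
  GRing.Zmodule.copy (bohr_int R) int.
HB.instance Definition _ (R : realType) :=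
  hasNbhs.Build (bohr_int R) (@bohr_nbhs R).

Section bohr_topology.
Variable R : realType.
Implicit Types (s : seq R) (e : R) (n m : int).

Lemma expi0 : expi (0 : R) = 1.
Proof. by rewrite /expi cos0 sin0. Qed.

Lemma expiD (a b : R) : expi (a + b) = expi a * expi b.
Proof. by rewrite /expi cosD sinD; simpc; rewrite [sin a * _ + _]addrC. Qed.

Lemma norm_expi (a : R) : `|expi a| = 1.
Proof. by rewrite normc_def /= cos2Dsin2 sqrtr1. Qed.

Lemma bohr_set0 s e : 0 < e -> bohr_set s e 0.
Proof.
by move=> e0 x _; rewrite mulr0 mul0r expi0 subrr normr0 ltcR.
Qed.

Lemma bohr_setD s e1 e2 n m :
  bohr_set s e1 n -> bohr_set s e2 m -> bohr_set s (e1 + e2) (n + m).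
Proof.
move=> hn hm x xs.
rewrite intrD mulrDr mulrDl expiD.
set a := expi _; set b := expi _.
have -> : a * b - 1 = a * (b - 1) + (a - 1) by ring.
apply: le_lt_trans (ler_normD _ _) _.
rewrite normrM norm_expi mul1r addrC rmorphD.
by apply: ltrD; [exact: hn | exact: hm].
Qed.

Lemma bohr_setN s e n : bohr_set s e n -> bohr_set s e (- n).
Proof.
move=> hn x xs; rewrite intrN mulrN mulNr.
have := hn x xs; set t := 2 * pi * _ * x.
suff -> : expi t - 1 = - (expi t * (expi (- t) - 1)).
  by rewrite normrN normrM norm_expi mul1r.
by rewrite mulrBr -expiD subrr expi0 mulr1 opprB.
Qed.

Lemma bohr_setI s1 s2 e1 e2 :
  bohr_set (s1 ++ s2) (Num.min e1 e2) `<=` bohr_set s1 e1 `&` bohr_set s2 e2.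
Proof.
move=> n h; split => x xs.
  have := h x; rewrite mem_cat xs => /(_ isT)/lt_le_trans; apply.
  by rewrite lecR ge_min lexx.
have := h x; rewrite mem_cat xs orbT => /(_ isT)/lt_le_trans; apply.
by rewrite lecR ge_min lexx orbT.
Qed.

Lemma bohr_nbhs_filter (n : bohr_int R) : ProperFilter (nbhs n).
Proof.
apply: filter_from_proper.
  apply: filter_from_filter.
    by exists ([:: 0], 1); split => //=; exact: ltr01.
  move=> [s1 e1] [s2 e2] [/= s10 e10] [/= s20 e20].
  exists (s1 ++ s2, Num.min e1 e2); last by move=> m /= /bohr_setI.
  by split; [case: s1 s10 | rewrite /= lt_min e10 e20].
move=> [s e] [/= _ e0]; exists n => /=.
by rewrite subrr; exact: bohr_set0.
Qed.

Lemma bohr_nbhs_singleton (n : bohr_int R) (A : set (bohr_int R)) :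
  nbhs n A -> A n.
Proof.
move=> [[s e] [/= _ e0]]; apply => /=.
by rewrite subrr; exact: bohr_set0.
Qed.

Lemma bohr_nbhs_nbhs (n : bohr_int R) (A : set (bohr_int R)) :
  nbhs n A -> nbhs n (nbhs^~ A).
Proof.
move=> [[s e] [/= s0 e0] sA].
exists (s, e / 2); first by split => //=; exact: divr_gt0.
move=> m /= hm; exists (s, e / 2); first by split => //=; exact: divr_gt0.
move=> k /= hk; apply: sA => /=.
have -> : k - (n : int) = (k - m) + (m - (n : int)) :> int by ring.
by rewrite (splitr e); exact: bohr_setD.
Qed.

HB.instance Definition _ := Nbhs_isNbhsTopological.Build (bohr_int R)
  bohr_nbhs_filter bohr_nbhs_singleton bohr_nbhs_nbhs.

Lemma nbhs0_bohr : nbhs (0 : bohr_int R) =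
  filter_from (bohr_index (R := R)) (fun i => bohr_set i.1 i.2).
Proof.
apply/seteqP; split => A [i hi iA]; exists i => // m; first move=> hm.
  by apply: iA; rewrite /= subr0.
by rewrite /= subr0; exact: iA.
Qed.

Lemma bohr_sub_continuous :
  continuous (fun x : bohr_int R * bohr_int R => x.1 - x.2).
Proof.
move=> [a b] A [[s e] [/= s0 e0] sA].
have he : bohr_index (s, e / 2) by split => //=; exact: divr_gt0.
exists ([set m : int | bohr_set s (e / 2) (m - (a : int))],
        [set m : int | bohr_set s (e / 2) (m - (b : int))]).
  by split; exists (s, e / 2).
move=> [m k] [/= hm hk]; apply: sA => /=.
have -> : (m : int) - k - ((a : int) - b) =
  (m - (a : int)) + (- (k - (b : int))) :> int.
  by rewrite /=; ring.
by rewrite (splitr e); apply: bohr_setD => //; exact: bohr_setN.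
Qed.

HB.instance Definition _ := PreTopologicalNmodule_isTopologicalZmodule.Build
  (bohr_int R) bohr_sub_continuous.

End bohr_topology.

Definition measure_preserving d (X : measurableType d) (R : realType)
    (mu : probability X R) (T : X -> X) : Prop :=
  measurable_fun setT T /\
  forall A, measurable A -> mu (T @^-1` A) = mu A.

(* T^h for h in Z, where [Tinv] is the inverse of [T]. *)
Definition iterz (X : Type) (T Tinv : X -> X) (h : int) : X -> X :=
  match h with
  | Posz n => iter n T
  | Negz n => iter n.+1 Tinv
  end.

(* Since E is a subset of Z, the sets T^{-h} A have to make sense for all h in
   Z, so T is invertible with measurable inverse. *)
Definition recurrent (R : realType) (E : set int) : Prop :=
  forall (d : measure_display) (X : measurableType d) (mu : probability X R)
    (T Tinv : X -> X),
    cancel T Tinv -> cancel Tinv T ->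
    measure_preserving mu T -> measurable_fun setT Tinv ->
    forall A : set X, measurable A -> (0 < mu A)%E ->
      exists2 h : int, E h & (0 < mu (A `&` iterz T Tinv h @^-1` A))%E.

(* Main.v *)
From HB Require Import structures.
Require Import Defs.
From mathcomp Require Import all_boot all_order all_algebra.
From mathcomp Require Import all_classical all_reals all_analysis.
From mathcomp Require Import complex.
From mathcomp Require Import lra zify.

Set Implicit Arguments.
Unset Strict Implicit.
Unset Printing Implicit Defensive.

Import Order.TTheory GRing.Theory Num.Theory.

Local Open Scope classical_set_scope.
Local Open Scope ring_scope.

(** Modulo [N = P + 1], where [P] is the product of the generators [p_i], every
   element of the semigroup S is a unit, so S avoids 0 mod [N]. Hence the
   translation by 1 on Z/N, with the uniform measure and the set {0}, shows that
   S is not recurrent.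
   An integer [n] that is neither 0 nor in S is separated from S modulo
   [N = P ^ (|n| + 1)]. Suppose [m = \prod_i p_i ^ a_i] is congruent to [n]
   mod [N]. No [a_i] exceeds [|n|], since otherwise [p_i ^ (|n| + 1)] would divide
   the nonzero [n]. So [m <= P ^ |n|], and [|m - n| < 2 * P ^ |n| <= N], whence
   [m = n]. Since congruence classes are Bohr open (take [x = 1/N]), S is Bohr
   closed. *)

(** * Congruence classes in the Bohr topology *)

Lemma expi_2pi_nat (R : realType) (n : nat) : expi (2 * pi * n%:R : R) = 1.
Proof.
have -> : 2 * pi * n%:R = 0 + (pi *+ 2) *+ n :> R.
  by rewrite add0r mulr_natr mulr_natl.
rewrite /expi (periodicn (@cosD2pi R)) (periodicn (@sinD2pi R)).
by rewrite cos0 sin0.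
Qed.

Lemma expi_2pi_int (R : realType) (n : int) : expi (2 * pi * n%:~R : R) = 1.
Proof.
case: (intP n) => [|k|k]; rewrite ?mulr0 ?expi0 ?expi_2pi_nat //.
(* For a negative integer, multiply by the value at the opposite angle, which is 1 by the natural
   case. *)
rewrite -[LHS]mulr1 -[X in _ * X](expi_2pi_nat R k.+1) -expiD.
by rewrite mulrNz mulrN addNr expi0.
Qed.

(** With t = pi k / N, strictly between 0 and pi, cos (2 t) = 1 - 2 (sin t)^2 and sin t > 0. *)
Lemma cos_2pi_frac_lt1 (R : realType) (k N : nat) :
  (0 < k < N)%N -> cos (2 * pi * (k%:R / N%:R)) < 1 :> R.
Proof.
move=> /andP[k0 kN].
have N0 : 0 < N%:R :> R by rewrite ltr0n (leq_trans k0 (ltnW kN)).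
have kN1 : 0 < (k%:R / N%:R : R) < 1.
  by rewrite ltr_pdivrMr // mul1r ltr_nat kN divr_gt0 // ltr0n.
rewrite -mulrA mulr_natl cos_mulr2n cos2sin2.
have : 0 < sin (pi * (k%:R / N%:R)) :> R.
  have := pi_gt0 R; move: kN1 => /andP[? ?] ?.
  by apply: sin_gt0_pi; rewrite mulr_gt0 //= gtr_pMr.
by move=> /(exprn_gt0 2); lra.
Qed.

(** Only the residue k of m mod N matters, and |z - 1| is at least 1 - Re z. So e can be the least
    gap 1 - cos (2 pi k / N) over nonzero residues, capped at 1 so that N = 1 is covered. *)
Lemma bohr_set_dvdz (R : realType) (N : nat) : (0 < N)%N ->
  exists2 e : R, 0 < e &
    forall m : int, bohr_set [:: N%:R^-1] e m -> (N %| m)%Z.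
Proof.
move=> N0.
pose e : R := \big[Order.min/1]_(k < N | (0 < k)%N)
  (1 - cos (2 * pi * (k%:R / N%:R))).
exists e.
  apply/bigmin_gtP; split=> // k k0.
  by rewrite subr_gt0 cos_2pi_frac_lt1 // k0 ltn_ord.
move=> m /(_ N%:R^-1); rewrite mem_head => /(_ isT).
have NR : N%:R != 0 :> R by rewrite pnatr_eq0 -lt0n.
have [k kE] : exists k : nat, (m %% N)%Z = k.
  by exists `|(m %% N)%Z|%N; rewrite gez0_abs // modz_ge0; lia.
have kN : (k < N)%N by have := ltz_pmod m (d := N); lia.
have -> : 2 * pi * m%:~R * N%:R^-1 =
    2 * pi * (m %/ N)%Z%:~R + 2 * pi * (k%:R / N%:R) :> R.
  rewrite {1}(divz_eq m N) kE intrD intrM -!mulrA -mulrDr; congr (2 * _).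
  by rewrite -mulrDr; congr (pi * _); rewrite mulrDl mulfK.
rewrite expiD expi_2pi_int mul1r => lt_e.
have [k0|k0] := posnP k; first by apply/dvdz_mod0P; rewrite kE k0.
have := le_lt_trans (normc_ge_Re _) lt_e.
rewrite ltcR /= ltr_norml => /andP[+ _].
have : e <= 1 - cos (2 * pi * (k%:R / N%:R)).
  exact: (bigmin_le_cond _ _ (j := Ordinal kN)).
by move=> le_e; rewrite ltrNl opprB => /(le_lt_trans le_e); rewrite ltxx.
Qed.

Lemma bohr_closed (R : realType) (E : set int) :
  (forall n, ~ E n -> exists2 N : nat, (0 < N)%N &
     forall m, E m -> ~~ (N %| m - n)%Z) ->
  closed (E : set (bohr_int R)).
Proof.
move=> sepE n clEn; apply: contrapT => /sepE[N N0 EN].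
have [e e0 dvdN] := bohr_set_dvdz R N0.
have [] := clEn [set m : int | bohr_set [:: N%:R^-1] e (m - (n : int))].
  by exists ([:: N%:R^-1], e).
by move=> m [/EN/negP + /dvdN]; exact.
Qed.

(** * The translation by 1 on Z/N with uniform measure *)

HB.instance Definition _ (n : nat) := isPointed.Build 'I_n.+1 ord0.
HB.instance Definition _ (n : nat) := @isMeasurable.Build
  default_measure_display 'I_n.+1 discrete_measurable discrete_measurable0
  discrete_measurableC discrete_measurableU.

Section uniform_ord.
Variables (R : realType) (n : nat).

(** [msum] takes a family indexed by all naturals, hence [inord]. *)
Definition uniform_ord : set 'I_n.+1 -> \bar R :=
  mscale (n.+1%:R^-1)%:nng (msum (fun k => \d_(inord k : 'I_n.+1)) n.+1).

HB.instance Definition _ := Measure.on uniform_ord.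

Lemma uniform_ordE (A : set 'I_n.+1) :
  uniform_ord A = ((n.+1%:R^-1)%:E * \sum_(k < n.+1) \d_k A)%E.
Proof.
rewrite /uniform_ord /mscale /msum /=; congr (_ * _)%E.
by apply: eq_bigr => k _; rewrite inord_val.
Qed.

Lemma uniform_ordT : uniform_ord setT = 1%E.
Proof.
rewrite uniform_ordE; under eq_bigr do rewrite diracT.
by rewrite sumEFin sumr_const card_ord -EFinM mulVf.
Qed.

HB.instance Definition _ :=
  Measure_isProbability.Build _ _ _ uniform_ord uniform_ordT.

End uniform_ord.

Lemma ord_iterz (n : nat) (h : int) (x : 'I_n.+2) :
  iterz (fun x => x + 1) (fun x => x - 1) h x = x + h%:~R.
Proof.
have iterE (a : 'I_n.+2) k : iter k (fun x => x + a) x = x + a *+ k.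
  by elim: k => [|k /= ->]; rewrite ?addr0 // mulrSr addrA.
by case: h => k; rewrite /iterz iterE // NegzE mulrNz mulNrn.
Qed.

Lemma not_recurrent_mod (R : realType) (E : set int) (N : nat) : (1 < N)%N ->
  (forall h, E h -> ~~ (N %| h)%Z) -> ~ recurrent R E.
Proof.
case: N => [|[|n]] // _ EN rec.
pose mu : probability 'I_n.+2 R := @uniform_ord R n.+1.
pose T (x : 'I_n.+2) := x + 1.
pose Tinv (x : 'I_n.+2) := x - 1.
have [] := rec _ _ mu T Tinv _ _ _ _ [set 0] _ _.
- exact: addrK.
- exact: subrK.
- split=> // A _; rewrite /= !uniform_ordE; congr (_ * _)%E.
  (* The translation permutes the equally weighted points. *)
  rewrite [RHS](reindex_inj (addIr 1)); apply: eq_bigr => k _.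
  by rewrite !diracE.
- by [].
- by [].
- rewrite /mu /= uniform_ordE mule_gt0 ?lte_fin ?invr_gt0 //.
  rewrite (bigD1 0) //= diracE mem_set //.
  by apply: (@lt_le_trans _ _ 1%E); rewrite ?lte_fin // leeDl ?sume_ge0.
move=> h /EN /negP Nh.
rewrite (_ : _ `&` _ = set0) ?measure0 ?ltxx //.
apply/seteqP; split=> // x /= [-> ]; rewrite ord_iterz add0r => h0.
apply: Nh; rewrite dvdzE /dvdn.
(* Vanishing in Z/N ignores the sign of h, and the value of a natural number in Z/N is its
   remainder. *)
have /(congr1 val) : `|h|%:R = 0 :> 'I_n.+2.
  by case: (intP h) h0 => // k; rewrite mulrNz => /eqP; rewrite oppr_eq0 => /eqP.
by rewrite Zp_nat /= => ->.
Qed.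

(** * Arithmetic of the semigroup *)

Lemma prod_ge1 r (p : r.-tuple int) : (forall i, 2 <= tnth p i) ->
  forall Q : pred 'I_r, 1 <= \prod_(i < r | Q i) tnth p i.
Proof.
move=> p2 Q; elim/big_ind: _ => [//|x y|i _]; first by nia.
by have := p2 i; lia.
Qed.

Lemma gen_semigroup_gt0 r (p : r.-tuple int) : (forall i, 2 <= tnth p i) ->
  forall n, gen_semigroup p n -> 0 < n.
Proof.
move=> p2 _ [a ->]; apply: prodr_gt0 => i _.
by rewrite exprn_gt0 // (lt_le_trans _ (p2 i)).
Qed.

(** Each generator divides P, hence is coprime to P + 1, and coprimality to P + 1 passes to
    products. *)
Lemma gen_semigroup_coprime_prodS r (p : r.-tuple int) m :
  gen_semigroup p m -> coprimez m (\prod_(i < r) tnth p i + 1).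
Proof.
move=> [a ->]; elim/big_ind: _ => [|x y xP yP|i _].
- by rewrite /coprimez gcd1z.
- by rewrite coprimezMl xP yP.
apply: coprimezXl; apply/coprimezP.
(* Bezout: - (P / p_i) * p_i + (P + 1) = 1. *)
exists (- \prod_(j < r | j != i) tnth p j, 1) => /=.
by rewrite [X in _ * (X + _)](bigD1 i) //= mulNr mul1r [X in - X]mulrC addKr.
Qed.

Lemma gen_semigroup_separated r (p : r.-tuple int) (n : int) :
  (1 <= r)%N -> (forall i, 2 <= tnth p i) -> n != 0 -> ~ gen_semigroup p n ->
  forall m, gen_semigroup p m ->
    ~~ ((\prod_(i < r) tnth p i) ^+ `|n|.+1 %| m - n)%Z.
Proof.
move=> r0 p2 n0 nS m mS; set P := \prod_(i < r) _; apply/negP => dvdP.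
have m_neq : m - n != 0 by apply: contra_notN nS; rewrite subr_eq0 => /eqP <-.
case: (mS) => a mE.
have a_le i : (a i <= `|n|)%N.
  rewrite leqNgt; apply/negP => n_lt.
  have : (tnth p i ^+ `|n|.+1 %| m - (m - n))%Z.
    apply: rpredB.
      by rewrite mE (bigD1 i) //= dvdz_mulr // dvdz_exp2l.
    apply: dvdz_trans dvdP; apply: dvdz_exp2r.
    by rewrite /P (bigD1 i) //= dvdz_mulr.
  rewrite subKr => /dvdn_leq; rewrite absz_gt0 => /(_ n0).
  rewrite abszX leqNgt => /negP; apply.
  by apply: ltn_trans (ltnSn _) (ltn_expl _ _); have := p2 i; lia.
have P2 : 2 <= P.
  (* One factor is at least 2, and the product of the others is at least 1; this is where r >= 1
     enters. *)
  rewrite /P (bigD1 (Ordinal r0)) //=.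
  by rewrite -[2]mulr1 ler_pM // (prod_ge1 p2).
have m_le : m <= P ^+ `|n|.
  rewrite mE /P -prodrXl; apply: ler_prod => i _.
  have p1 : 1 <= tnth p i by have := p2 i; lia.
  by rewrite exprn_ge0 ?(le_trans _ p1) //= ler_weXn2l.
have n_lt : `|n| < P ^+ `|n|%N.
  apply: (@lt_le_trans _ _ (2 ^+ `|n|%N)); last by rewrite lerXn2r ?nnegrE; lia.
  by rewrite -abszE -natz -natrX ltr_nat ltn_expl.
have := dvdn_leq _ dvdP; rewrite absz_gt0 => /(_ m_neq).
rewrite -lez_nat !abszE exprS ger0_norm; last by nia.
have := gen_semigroup_gt0 p2 mS; nia.
Qed.

Lemma gen_semigroup_ndvd_prodS r (p : r.-tuple int) :
  (forall i, 2 <= tnth p i) -> forall m, gen_semigroup p m ->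
    ~~ (\prod_(i < r) tnth p i + 1 %| m)%Z.
Proof.
move=> p2 m /gen_semigroup_coprime_prodS.
rewrite coprimez_sym /coprimez => copP; apply/negP => /gcdz_idPl.
rewrite (eqP copP) => P1.
have := prod_ge1 p2 xpredT; lia.
Qed.

(** * Closedness and non-recurrence *)

Lemma gen_semigroup_closed (R : realType) r (p : r.-tuple int) :
  (1 <= r)%N -> (forall i, 2 <= tnth p i) ->
  closed (gen_semigroup p : set (bohr_int R)).
Proof.
move=> r0 p2; apply: bohr_closed => n nS.
have P1 := prod_ge1 p2 xpredT.
(* No power of P separates 0 from S, since S contains these powers; a modulus coprime to the
   generators is used instead. *)
have [->|n0] := eqVneq n 0.
  exists `|(\prod_(i < r) tnth p i + 1)%R|%N => [|m mS]; first by lia.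
  by rewrite subr0 dvdzE absz_nat -dvdzE gen_semigroup_ndvd_prodS.
exists `|((\prod_(i < r) tnth p i) ^+ `|n|.+1)%R|%N => [|m mS].
  by rewrite absz_gt0 expf_neq0 //; lia.
by rewrite dvdzE absz_nat -dvdzE gen_semigroup_separated.
Qed.

Lemma gen_semigroup_not_recurrent (R : realType) r (p : r.-tuple int) :
  (forall i, 2 <= tnth p i) -> ~ recurrent R (gen_semigroup p).
Proof.
move=> p2; have P1 := prod_ge1 p2 xpredT.
apply: (@not_recurrent_mod _ _ `|(\prod_(i < r) tnth p i + 1)%R|%N) => [|m mS].
  by lia.
by rewrite dvdzE absz_nat -dvdzE gen_semigroup_ndvd_prodS.
Qed.

Theorem theorem4p13 (R : realType) :
  (forall (r : nat) (p : r.-tuple int),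
     (1 <= r)%N ->
     (forall i : 'I_r, 2 <= tnth p i) ->
     (forall i j : 'I_r, i != j -> coprimez (tnth p i) (tnth p j)) ->
     closed (gen_semigroup p : set (bohr_int R)) /\
     ~ recurrent R (gen_semigroup p)) /\
  (gen_semigroup [tuple 2; 3] =
     [set n : int | exists j k : nat, n = 2 ^+ j * 3 ^+ k] /\
   closed (gen_semigroup [tuple 2; 3] : set (bohr_int R)) /\
   ~ recurrent R (gen_semigroup [tuple 2; 3])).
Proof.
split=> [r p r0 p2 _|].
  by split; [exact: gen_semigroup_closed | exact: gen_semigroup_not_recurrent].
have p2 i : 2 <= tnth [tuple 2; 3] i :> int.
  by rewrite (tnth_nth 0); case: i => -[|[|]].
split; last first.
  by split; [exact: gen_semigroup_closed | exact: gen_semigroup_not_recurrent].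
apply/seteqP; split=> n /= [a].
  rewrite !big_ord_recl big_ord0 mulr1 /= => ->.
  by exists (a ord0), (a (lift ord0 ord0)).
move=> [k ->]; exists (fun i => if i == ord0 then a else k).
by rewrite !big_ord_recl big_ord0 mulr1.
Qed.
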